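(* Assume $n\ge 2d$, let $\widetilde X$ be a knockoff matrix with $X^\top\widetilde X=X^\top X-D$, set $\Delta=2D^{-1}$, and couple the two formulations via $\omega=D^{-1}(X-\widetilde X)^\top y-\widehat\beta$ (so that $\widetilde\beta=\widehat\beta+\omega=D^{-1}(X-\widetilde X)^\top y$ and $\xi=\Sigma^{-1}\widehat\beta-\Delta^{-1}\widetilde\beta=\tfrac12(X+\widetilde X)^\top y$). Then: (a) For any implementation of the whitening method with this $\Delta$ and this $\omega$, there exist $W$-statistics satisfying the unordered pair property such that the standard knockoff+ procedure with these $W$-statistics and the whitening method give identical rejection sets. (b) For any $W$-statistics satisfying the unordered pair property such that $|W_1|,\dots,|W_d|$ are almost surely positive and pairwise distinct, there exists an implementation of the whitening method with this $\Delta$ and this $\omega$ such that the two methods give identical rejection sets.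
   Context: Linear model: $X\in\mathbb R^{n\times d}$ of full column rank, $y=X\beta+\varepsilon$, $\varepsilon\sim\mathcal N_n(0,\sigma^2I_n)$; $\Sigma=(X^\top X)^{-1}$, $\widehat\beta=\Sigma X^\top y$. A knockoff matrix is $\widetilde X\in\mathbb R^{n\times d}$ with $\widetilde X^\top\widetilde X=X^\top X$ and $\widetilde X^\top X=X^\top X-D$, $D$ diagonal with positive diagonal entries and $D\preceq 2X^\top X$. $W$-statistics are functions $W=(W_1,\dots,W_d)$ of $([X\ \widetilde X],y)$; set $W_j^*=\operatorname{sgn}((X_j-\widetilde X_j)^\top y)W_j$. $W$ has the unordered pair property if (for fixed $X,\widetilde X$) $W^*$ depends on $y$ only through the unordered pairs $\{X_j^\top y,\widetilde X_j^\top y\}$, $j=1,\dots,d$. Standard knockoff+ procedure at level $\alpha\in(0,1)$: let $\hat t$ be the smallest $t\in\{|W_j|:|W_j|>0\}$ with $\frac{1+\#\{j:W_j\le -t\}}{\#\{j:W_j\ge t\}}\le\alpha$ ($\hat t=+\infty$ if none) and reject $H_j:\beta_j=0$ for all $j$ with $W_j\ge\hat t$. Whitening method at level $\alpha$ for a diagonal $\Delta\succeq\Sigma$ and noise $\omega\sim\mathcal N_d(0,\sigma^2(\Delta-\Sigma))$ independent of $\widehat\beta$: set $\widetilde\beta=\widehat\beta+\omega$, $\xi=\Sigma^{-1}\widehat\beta-\Delta^{-1}\widetilde\beta$. An implementation is a rule that, as a function of $(\xi,|\widetilde\beta|)$, outputs an ordering $[1],\dots,[d]$ of $\{1,\dots,d\}$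 and signs $\psi_1,\dots,\psi_d\in\{-1,+1\}$. Put $\widetilde p_j=1/2$ if $\operatorname{sgn}(\widetilde\beta_j)=\psi_j$ and $\widetilde p_j=1$ otherwise; $\widehat{\mathrm{FDP}}_k=\frac{1+\#\{j\le k:\widetilde p_{[j]}=1\}}{\#\{j\le k:\widetilde p_{[j]}=1/2\}}$ (equal to $+\infty$ if the denominator is $0$); $\hat k=\max\{k\le d:\widehat{\mathrm{FDP}}_k\le\alpha\}$ ($\hat k=0$ if none); reject $H_{[j]}$ for all $j\le\hat k$ with $\widetilde p_{[j]}=1/2$. *)

(* Defs.v *)
From HB Require Import structures.
From mathcomp Require Import all_boot all_order all_algebra all_fingroup.
From mathcomp Require Import all_classical all_reals all_analysis.
Set Implicit Arguments. Unset Strict Implicit. Unset Printing Implicit Defensive.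
Import Order.TTheory GRing.Theory Num.Theory.
Local Open Scope classical_set_scope.
Local Open Scope ring_scope.

Section KnockoffWhitening.
Variable R : realType.
Variables n d : nat.

Definition is_knockoff (X Xt : 'M[R]_(n, d)) (Dv : 'rV[R]_d) : Prop :=
  [/\ Xt^T *m Xt = X^T *m X,
      Xt^T *m X = X^T *m X - diag_mx Dv,
      (forall j, 0 < Dv 0 j) &
      (forall v : 'cV[R]_d,
          0 <= (v^T *m ((2%:R : R) *: (X^T *m X) - diag_mx Dv) *m v) 0 0)].

Definition Sigma (X : 'M[R]_(n, d)) : 'M[R]_d := invmx (X^T *m X).
Definition betahat (X : 'M[R]_(n, d)) (y : 'cV[R]_n) : 'cV[R]_d :=
  Sigma X *m X^T *m y.

Definition sgnval (b : bool) : R := if b then 1 else -1.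

(* An implementation: given (xi, |betatilde|), an ordering [1],...,[d]
   (position i, 0-indexed, holds index s i) and signs psi_1..psi_d. *)
Definition implementation := 'cV[R]_d -> 'cV[R]_d -> prod {perm 'I_d} ('I_d -> bool).

Definition betatilde X y (omega : 'cV[R]_d) : 'cV[R]_d := betahat X y + omega.

Definition xi X y (Delta : 'M[R]_d) (omega : 'cV[R]_d) : 'cV[R]_d :=
  invmx (Sigma X) *m betahat X y - invmx Delta *m betatilde X y omega.

Definition ptilde (bt : 'cV[R]_d) (psi : 'I_d -> bool) (j : 'I_d) : R :=
  if Num.sg (bt j 0) == sgnval (psi j) then 2^-1 else 1.

(* FDP-hat_k, k = 0..d, positions j <= k (1-indexed) are i < k (0-indexed) *)
Definition fdp_hat (bt : 'cV[R]_d) (s : {perm 'I_d}) (psi : 'I_d -> bool)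
    (k : nat) : \bar R :=
  let num := #|[set i : 'I_d | (i < k)%N && (ptilde bt psi (s i) == 1)]| in
  let den := #|[set i : 'I_d | (i < k)%N && (ptilde bt psi (s i) == 2^-1)]| in
  if den == 0%N then +oo%E else (((1 + num%:R) / den%:R)%:E)%E.

Definition khat (bt : 'cV[R]_d) s psi (alpha : R) : nat :=
  \max_(k < d.+1 | (fdp_hat bt s psi k <= alpha%:E)%E) k.

Definition whitening_rej (X : 'M[R]_(n, d)) (Delta : 'M[R]_d)
    (omega : 'cV[R]_d) (I : implementation) (alpha : R) (y : 'cV[R]_n)
    : {set 'I_d} :=
  let bt := betatilde X y omega in
  let s := (I (xi X y Delta omega) (map_mx Num.norm bt)).1 in
  let psi := (I (xi X y Delta omega) (map_mx Num.norm bt)).2 in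
  [set j | [exists i : 'I_d, [&& (i < khat bt s psi alpha)%N, s i == j &
                                  ptilde bt psi j == 2^-1]]].

(* W-statistics, for fixed X, Xt, as functions of y *)
Definition Wstat := 'cV[R]_n -> 'I_d -> R.

Definition kplus_ok (W : 'I_d -> R) (alpha t : R) : bool :=
  let neg := #|[set j | W j <= - t]| in
  let pos := #|[set j | t <= W j]| in
  (pos != 0%N) && ((1 + neg%:R) / pos%:R <= alpha).

Definition kplus_that (W : 'I_d -> R) (alpha : R) : \bar R :=
  \big[Order.min/+oo%E]_(j | (0 < `|W j|) && kplus_ok W alpha `|W j|)
     ((`|W j|)%:E).

Definition kplus_rej (W : 'I_d -> R) (alpha : R) : {set 'I_d} :=
  [set j | (kplus_that W alpha <= (W j)%:E)%E].

Definition Wstar (X Xt : 'M[R]_(n, d)) (W : Wstat) (y : 'cV[R]_n) (j : 'I_d) : R :=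
  Num.sg (((X - Xt)^T *m y) j 0) * W y j.

Definition same_unordered_pair (a b a' b' : R) : Prop :=
  (a = a' /\ b = b') \/ (a = b' /\ b = a').

Definition unordered_pair_property (X Xt : 'M[R]_(n, d)) (W : Wstat) : Prop :=
  forall y y' : 'cV[R]_n,
    (forall j : 'I_d, same_unordered_pair ((X^T *m y) j 0) ((Xt^T *m y) j 0)
                                          ((X^T *m y') j 0) ((Xt^T *m y') j 0)) ->
    forall j, Wstar X Xt W y j = Wstar X Xt W y' j.

End KnockoffWhitening.

Definition iid_gaussian_noise (R : realType) (d0 : measure_display)
    (Omega : measurableType d0) (P : probability Omega R) (n : nat)
    (sigma : R) (eps : 'I_n -> Omega -> R) : Prop :=
  (forall i, measurable_fun setT (eps i)) /\
  (forall i (A : set R), measurable A ->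
      P (eps i @^-1` A) = normal_prob 0 sigma A) /\
  (forall A : 'I_n -> set R, (forall i, measurable (A i)) ->
      P (\bigcap_(i in [set: 'I_n]) (eps i @^-1` A i)) =
      (\prod_(i < n) P (eps i @^-1` A i))%E).

(* Main.v *)
(** In the coupling, [xi = (X + Xt)^T y / 2] and
    [betatilde = D^-1 (X - Xt)^T y], so the data [(xi, |betatilde|)] seen by an
    implementation carries exactly the information of the unordered pairs.
    Whenever [s] lists the indices by strictly decreasing [|W_j|] and
    [ptilde_j = 1/2] iff [W_j > 0], the threshold [t = |W_(s i)|] has the same
    estimate as the prefix of length [i + 1], so both procedures reject the same
    set.  For (a) take [W_j] to be [+/- (d - rank of j)], positive iff
    [ptilde_j = 1/2].  For (b) sort by [|W*|] and take [psi = sgn W*], both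
    functions of the unordered pairs; they describe [W] as soon as no coordinate
    of [(X - Xt)^T y] vanishes.  This holds almost surely, since these
    coordinates are nonconstant linear forms in the Gaussian noise: cutting the
    other noise coordinates into cells of side [e], the event forces one
    coordinate into an interval of length [O(e)] on each cell, whence probability
    [O(e)]. *)
Require Import Defs.
From HB Require Import structures.
From mathcomp Require Import all_boot all_order all_algebra all_fingroup.
From mathcomp Require Import all_classical all_reals all_analysis.
From mathcomp Require Import measurable_realfun ring lra.
Import Order.TTheory GRing.Theory Num.Theory.
Local Open Scope classical_set_scope.
Local Open Scope ring_scope.

(** * Permutations: reindexing counts and sorting *)

Lemma card_mkset_perm (T : finType) (s : {perm T}) (A B : pred T) :
  (forall i, A (s i) = B i) ->
  #|[set j | A j]%classic| = #|[set i | B i]%classic|.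
Proof.
move=> AB; rewrite -!sum1_card (reindex_perm s) /=; apply: eq_bigl => i.
by apply/idP/idP; rewrite !in_setE /= AB.
Qed.

Lemma sorting_perm (R : realDomainType) (d : nat) (f : 'I_d -> R) :
  exists s : {perm 'I_d}, forall i j : 'I_d, (i <= j)%N -> f (s j) <= f (s i).
Proof.
pose leT := [rel a b : 'I_d | f b <= f a].
have trT : transitive leT by move=> a b c /= ba ac; exact: le_trans ac ba.
have reT : reflexive leT by move=> a /=.
have toT : total leT by move=> a b /=; exact: le_total.
have /tuple_permP[s Es] : perm_eq (sort leT (enum 'I_d)) (ord_tuple d).
  by rewrite val_ord_tuple perm_sort.
have sz : size (sort leT (enum 'I_d)) = d by rewrite size_sort size_enum_ord.
have st := sort_sorted toT (enum 'I_d).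
exists s => i j ij.
have := sorted_leq_nth trT reT i st.
rewrite sz => /(_ i j (ltn_ord i) (ltn_ord j) ij).
by rewrite Es !nth_mktuple !tnth_ord_tuple.
Qed.

(** * Rejection sets of the two procedures under a common ordering *)

Section RejectionSets.
Variables (R : realType) (d : nat).
Implicit Types (bt : 'cV[R]_d) (psi : 'I_d -> bool).

Lemma half_neq1 : (2^-1 == 1 :> R) = false.
Proof. by apply/negbTE/eqP => h; lra. Qed.

Lemma ptilde_eq_half bt psi j :
  (ptilde bt psi j == 2^-1) = (Num.sg (bt j 0) == sgnval R (psi j)).
Proof. by rewrite /ptilde; case: ifP => _; rewrite ?eqxx // eq_sym half_neq1. Qed.

Lemma ptilde_eq1 bt psi j :
  (ptilde bt psi j == 1) = (Num.sg (bt j 0) != sgnval R (psi j)).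
Proof. by rewrite /ptilde; case: ifP => _; rewrite ?eqxx // half_neq1. Qed.

Section Matched.
Variables (W : 'I_d -> R) (bt : 'cV[R]_d) (s : {perm 'I_d}).
Variables (psi : 'I_d -> bool) (alpha : R).
Hypothesis W_gt0 : forall j, 0 < `|W j|.
Hypothesis W_sorted : forall i j : 'I_d, (i < j)%N -> `|W (s j)| < `|W (s i)|.
Hypothesis W_sign : forall j, (Num.sg (bt j 0) == sgnval R (psi j)) = (0 < W j).

Lemma sorted_leW (i j : 'I_d) : (`|W (s j)| <= `|W (s i)|) = (i <= j)%N.
Proof.
case: (ltngtP i j) => [/W_sorted/ltW//|/W_sorted h|/ord_inj->].
  by apply/negbTE; rewrite -ltNge.
by rewrite lexx.
Qed.

(** Reindexing by [s] turns the counts beyond a threshold into counts over a prefix. Positions start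
    at 0, so the prefix ending at [i] has length [i.+1]. *)
Lemma kplus_okE (i : 'I_d) :
  kplus_ok W alpha `|W (s i)| = (fdp_hat bt s psi i.+1 <= alpha%:E)%E.
Proof.
rewrite /kplus_ok /fdp_hat /=.
rewrite (card_mkset_perm _ s (fun j => W j <= - `|W (s i)|)
  (fun k : 'I_d => (k < i.+1)%N && (ptilde bt psi (s k) == 1))); last first.
  move=> k; rewrite ptilde_eq1 W_sign ltnS -sorted_leW -leNgt.
  case: (lerP (W (s k)) 0) => h; rewrite ?andbT ?andbF.
    by rewrite (ler0_norm h) lerNr.
  by apply/negbTE; rewrite -ltNge (lt_trans _ h)// oppr_lt0.
rewrite (card_mkset_perm _ s (fun j => `|W (s i)| <= W j)
  (fun k : 'I_d => (k < i.+1)%N && (ptilde bt psi (s k) == 2^-1))); last first.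
  move=> k; rewrite ptilde_eq_half W_sign ltnS -sorted_leW.
  case: (ltrP 0 (W (s k))) => h; rewrite ?andbT ?andbF.
    by rewrite (gtr0_norm h).
  by apply/negbTE; rewrite -ltNge (le_lt_trans h).
by case: ifP => //=.
Qed.

(** Neither extremum is computed: [W j] reaches [kplus_that] iff it reaches some admissible
    threshold, and a position lies below [khat] iff it lies below some admissible [k]. *)
Lemma matched_rejections :
  kplus_rej W alpha =
  [set j | [exists i : 'I_d, [&& (i < khat bt s psi alpha)%N, s i == j &
                                  ptilde bt psi j == 2^-1]]]%SET.
Proof.
apply/setP => j; rewrite !inE /kplus_that; apply/bigmin_leP/existsP.
  (* The first case is the default [+oo] of an empty minimum, which no real [W j] reaches. *)
  case=> [//|[l /andP[_ ok]]]; rewrite lee_fin => le_l.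
  have Wj0 : 0 < W j by exact: lt_le_trans (W_gt0 l) le_l.
  have El : l = s (s^-1%g l) by rewrite permKV.
  have Ej : j = s (s^-1%g j) by rewrite permKV.
  exists (s^-1%g j); rewrite permKV eqxx ptilde_eq_half W_sign Wj0 /= andbT.
  have il : (s^-1%g j <= s^-1%g l)%N by rewrite -sorted_leW -El -Ej (gtr0_norm Wj0).
  move: ok; rewrite El kplus_okE => ok.
  apply: (@leq_trans (s^-1%g l).+1) => //.
  have lt : ((s^-1%g l).+1 < d.+1)%N by rewrite ltnS.
  exact: (leq_bigmax_cond (Ordinal lt)).
move=> [i /and3P[ik /eqP sij]]; rewrite ptilde_eq_half W_sign => Wj0; right.
have [k ok ltik] : exists2 k : 'I_d.+1, (fdp_hat bt s psi k <= alpha%:E)%E & (i < k)%N.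
  apply: contraPP ik => nex; apply/negP; rewrite -leqNgt.
  apply/bigmax_leqP => k ok; rewrite leqNgt; apply/negP => h.
  by apply: nex; exists k.
(* As [k > i], the prefix of length [k] is nonempty and ends at position [k.-1], which supplies the
   threshold. *)
have kd : (k.-1 < d)%N by case: k ltik {ok} => -[].
have Ek : k = (Ordinal kd).+1 :> nat by rewrite /= (ltn_predK ltik).
exists (s (Ordinal kd)); first by rewrite W_gt0 kplus_okE -Ek.
rewrite lee_fin -(gtr0_norm Wj0) -sij sorted_leW -ltnS -Ek //.
Qed.

End Matched.
End RejectionSets.

(** * Linear forms in Gaussian noise have no atoms *)

Section GaussianLinearForms.
Variables (R : realType) (sigma : R).
Hypothesis sigma_gt0 : 0 < sigma.

Lemma normal_prob_itv_le (a b : R) : a <= b ->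
  (normal_prob 0 sigma `[a, b] <= (normal_peak sigma * (b - a))%:E)%E.
Proof.
move=> ab; have s0 : sigma != 0 by rewrite gt_eqF.
rewrite /normal_prob.
apply: (@le_trans _ _ (\int[lebesgue_measure]_(x in `[a, b]) cst (normal_peak sigma)%:E x)%E).
  apply: ge0_le_integral => //.
  - by move=> x _; rewrite lee_fin normal_pdf_ge0.
  - apply/measurable_EFinP; apply: (measurable_funS measurableT) => //.
    exact: measurable_normal_pdf.
  - by move=> x _; rewrite lee_fin normal_pdf_ub.
rewrite integral_cst//=.  rewrite lebesgue_measure_itv /= lte_fin.
case: ifPn => [_|]; first by rewrite -EFinB -EFinM.
by rewrite mule0 lee_fin mulr_ge0 ?normal_peak_ge0// subr_ge0.
Qed.

Variables (d0 : measure_display) (Omega : measurableType d0).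
Variables (P : probability Omega R) (n : nat) (eps : 'I_n -> Omega -> R).
Hypothesis noise : iid_gaussian_noise P sigma eps.

Let meps i : measurable_fun setT (eps i) := noise.1 i.

Let box (A : 'I_n -> set R) : set Omega :=
  \bigcap_(i in [set: 'I_n]) (eps i @^-1` A i).

Let measurable_preim i A : measurable A -> measurable (eps i @^-1` A).
Proof. by move=> mA; rewrite -[X in measurable X]setTI; exact: meps. Qed.

Let measurable_box A : (forall i, measurable (A i)) -> measurable (box A).
Proof.
by move=> mA; apply: fin_bigcap_measurable => // i _; exact: measurable_preim.
Qed.

(** By independence both sides are products that differ only in the factor [k], which is 1 for [A]
    and a Gaussian interval mass for [B]. *)
Let box_le (k : 'I_n) (A B : 'I_n -> set R) (a b : R) :
  a <= b -> (forall i, measurable (A i)) ->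
  (forall i, i != k -> B i = A i) -> A k = setT -> B k = `[a, b]%classic ->
  (P (box B) <= (normal_peak sigma * (b - a))%:E * P (box A))%E.
Proof.
move=> ab mA BA Ak Bk.
have mB i : measurable (B i).
  by have [->|/BA->//] := eqVneq i k; rewrite Bk.
rewrite (noise.2.2 _ mA) (noise.2.2 _ mB) (bigD1 k)//=.
rewrite [X in (_ <= _ * X)%E](bigD1 k)//=.
rewrite Ak preimage_setT probability_setT mul1e.
rewrite (eq_bigr (fun i => P (eps i @^-1` A i))); last by move=> i /BA->.
apply: lee_wpmul2r; first by apply: prode_ge0.
by rewrite noise.2.1 Bk//; exact: normal_prob_itv_le.
Qed.

Lemma gaussian_linear_form_atomless (a : 'I_n -> R) (c : R) (k : 'I_n) :
  a k != 0 -> {ae P, forall w, \sum_i a i * eps i w != c}.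
Proof.
move=> ak0; pose E := [set w | \sum_i a i * eps i w = c].
have mE : measurable E.
  have mf : measurable_fun setT (fun w => \sum_i a i * eps i w).
    by apply: measurable_sum => i; exact: measurable_funM.
  by rewrite -[E]setTI; exact: (mf measurableT [set c] (measurable_set1 c)).
suff PE0 : P E = 0%E by exists E; split=> // w /= /negP; rewrite negbK => /eqP.
pose S := \sum_(i | i != k) `|a i|.
have S0 : 0 <= S by apply: sumr_ge0.
(* [K * e] is the density peak times the length of an interval of radius [S * e / |a k|]. *)
pose K := normal_peak sigma * (2 * S / `|a k|).
have K0 : 0 <= K by rewrite mulr_ge0 ?normal_peak_ge0// !mulr_ge0 ?invr_ge0.
suff le_PE e : 0 < e -> (P E <= (K * e)%:E)%E.
  apply/eqP; rewrite eq_le measure_ge0 andbT; apply/lee_addgt0Pr => e e0.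
  (* [K] vanishes when the form involves [eps k] alone, hence the divisor [K + 1]. *)
  rewrite add0e; apply: le_trans (le_PE (e / (K + 1)) _) _.
    by rewrite divr_gt0// ltr_wpDl.
  rewrite lee_fin mulrA ler_pdivrMr ?ltr_wpDl// mulrC ler_wpM2l ?ltW//; lra.
move=> e0.
pose cell (q : int) : set R := `[q%:~R * e, (q + 1)%:~R * e[%classic.
pose A (q : {ffun 'I_n -> int}) i := if i == k then setT else cell (q i).
(* On the cell [q] the equation pins [eps k] down up to [S * e / `|a k|]. *)
pose x (q : {ffun 'I_n -> int}) :=
  (c - \sum_(i | i != k) a i * ((q i)%:~R * e)) / a k.
pose r := S * e / `|a k|.
have r0 : 0 <= r by rewrite !mulr_ge0 ?invr_ge0// ltW.
pose B (q : {ffun 'I_n -> int}) i :=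
  if i == k then `[x q - r, x q + r]%classic else A q i.
have mA q i : measurable (A q i) by rewrite /A /cell; case: ifP.
have mB q i : measurable (B q i) by rewrite /B; case: ifP.
(* fixing [q k = 0] makes the boxes [A q] disjoint *)
pose Q m : option {ffun 'I_n -> int} :=
  if @pickle_inv {ffun 'I_n -> int} m is Some q then if q k == 0 then Some q else None else None.
pose G m := if Q m is Some q then box (A q) else set0.
pose F m := if Q m is Some q then box (B q) else set0.
have mG m : measurable (G m) by rewrite /G; case: (Q m) => // q; exact: measurable_box.
have mF m : measurable (F m) by rewrite /F; case: (Q m) => // q; exact: measurable_box.
have EF : E `<=` \bigcup_m F m.
  move=> w Ew.
  pose q := [ffun i => if i == k then 0 else Num.floor (eps i w / e)].
  have qk0 : q k == 0 by rewrite ffunE eqxx.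
  exists (pickle q) => //; rewrite /F /Q pickleK_inv qk0 => i _ /=.
  rewrite /B /A; case: ifPn => ik; last first.
    rewrite /cell set_itvco /= ffunE (negbTE ik).
    by have := floor_itv (eps i w / e); rewrite ler_pdivlMr// ltr_pdivrMr.
  rewrite (eqP ik) set_itvcc /= -ler_distl.
  (* Solving the equation for [eps k] expresses the deviation from [x q] through the distances of
     the other coordinates to their cell corners, each at most [e]. *)
  have -> : eps k w - x q =
      (\sum_(i | i != k) a i * ((q i)%:~R * e - eps i w)) / a k.
    rewrite /x; under [in RHS]eq_bigr do rewrite mulrBr.
    rewrite sumrB; move: Ew; rewrite /E /= (bigD1 k)//= => <-.
    by field.
  rewrite normrM normfV /r ler_pM2r ?invr_gt0 ?normr_gt0//.
  apply: le_trans (ler_norm_sum _ _ _) _.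
  rewrite mulr_suml; apply: ler_sum => l lk.
  rewrite normrM ler_wpM2l// ffunE (negbTE lk).
  have := floor_itv (eps l w / e).
  rewrite ler_pdivlMr// ltr_pdivrMr// intrD mulrDl mul1r => /andP[h1 h2].
  by rewrite ler_norml; apply/andP; split; lra.
have Qpickle m q : Q m = Some q -> m = pickle q /\ q k = 0.
  rewrite /Q; have := @pickle_invK {ffun 'I_n -> int} m.
  by case: (pickle_inv m) => //= q' <-; case: eqP => // q0 [<-].
have dG : trivIset setT G.
  move=> m m' _ _ [w []]; rewrite /G.
  case EQ : (Q m) => [q|//] Aq; case EQ' : (Q m') => [q'|//] Aq'.
  have [-> q0] := Qpickle _ _ EQ; have [-> q'0] := Qpickle _ _ EQ'.
  congr pickle; apply/ffunP => i.
  have [->|ik] := eqVneq i k; first by rewrite q0 q'0.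
  (* Lying in [cell (q i)] says that [q i] is the floor of [eps i w / e], so a common point forces
     equal indices. *)
  have := Aq i I; have := Aq' i I; rewrite /A (negbTE ik) /cell !set_itvco /=.
  rewrite -!ler_pdivlMr// -!ltr_pdivrMr// => /floor_def <- /floor_def <-//.
apply: le_trans (measure_sigma_subadditive _ mF mE EF) _.
apply: (@le_trans _ _ (\sum_(0 <= m <oo) ((K * e)%:E * P (G m)))%E).
  apply: lee_nneseries => // m _; rewrite /F /G.
  case: (Q m) => [q|]; last by rewrite !measure0 mule0.
  have -> : K * e = normal_peak sigma * (x q + r - (x q - r)).
    by rewrite /K /r -mulrA; congr (_ * _); lra.
  apply: (@box_le k) => //.
  - by lra.
  - by move=> i ik; rewrite /B (negbTE ik).
  - by rewrite /A eqxx.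
  - by rewrite /B eqxx.
(* The [G m] are disjoint, so their probabilities sum to at most 1. *)
rewrite nneseriesZl// -measure_semi_bigcup//; last exact: bigcup_measurable.
rewrite -[leRHS]mule1; apply: lee_wpmul2l.
  by rewrite lee_fin mulr_ge0 // ltW.
by apply: probability_le1; exact: bigcup_measurable.
Qed.

End GaussianLinearForms.

(** * Gram matrices of the design and of the contrast [X - Xt] *)

Lemma gram_unitmx (R : realFieldType) (n d : nat) (X : 'M[R]_(n, d)) :
  \rank X = d -> X^T *m X \in unitmx.
Proof.
move=> rX; rewrite -row_free_unit; apply: inj_row_free => v vXX0.
have /row_freeP[Y XY] : row_free X^T by rewrite /row_free mxrank_tr rX.
suff vX0 : v *m X^T = 0 by rewrite -[v]mulmx1 -XY mulmxA vX0 mul0mx.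
have : (v *m X^T *m (v *m X^T)^T) 0 0 = 0.
  by rewrite trmx_mul trmxK !mulmxA -(mulmxA v) vXX0 mul0mx mxE.
rewrite mxE; under eq_bigr do rewrite [X in _ * X]mxE -expr2.
move=> /eqP; rewrite psumr_eq0 => [/allP h|i _]; last exact: sqr_ge0.
apply/rowP => i; have := h i (mem_index_enum _).
by rewrite sqrf_eq0 [RHS]mxE => /eqP.
Qed.

Lemma knockoff_contrast_gram (R : realType) (n d : nat)
    (X Xt : 'M[R]_(n, d)) (Dv : 'rV[R]_d) :
  is_knockoff X Xt Dv -> (X - Xt)^T *m (X - Xt) = 2 *: diag_mx Dv.
Proof.
move=> [XtXt XtX _ _].
have XXt : X^T *m Xt = X^T *m X - diag_mx Dv.
  by rewrite -[LHS]trmxK trmx_mul trmxK XtX linearB /= trmx_mul trmxK tr_diag_mx.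
rewrite [(X - Xt)^T]linearB /= mulmxBl !mulmxBr XtXt XtX XXt scaler_nat.
by rewrite !opprB !subrKC mulr2n.
Qed.

(** Column [j] of the contrast has squared norm [2 * Dv 0 j > 0]. The entry found is the nonzero
    noise coefficient of the Gaussian form. *)
Lemma knockoff_contrast_neq0 (R : realType) (n d : nat)
    (X Xt : 'M[R]_(n, d)) (Dv : 'rV[R]_d) (j : 'I_d) :
  is_knockoff X Xt Dv -> exists k, (X - Xt) k j != 0.
Proof.
move=> kX; have [_ _ D0 _] := kX.
apply/existsP; rewrite -negb_forall; apply/negP => /forallP X0.
have := congr1 (fun M : 'M[R]_d => M j j) (knockoff_contrast_gram _ _ _ _ _ _ kX).
rewrite mxE big1 => [|k _].
  rewrite !mxE eqxx mulr1n => /esym/eqP.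
  by rewrite mulf_eq0 pnatr_eq0 /= gt_eqF.
by rewrite (eqP (X0 k)) mulr0.
Qed.

(** Up to positive factors, [xi] records the sum of a pair and [|betatilde|] its absolute
    difference. *)
Lemma same_unordered_pair_sumdiff (R : realType) (a b a' b' : R) :
  same_unordered_pair a b a' b' <-> a + b = a' + b' /\ `|a - b| = `|a' - b'|.
Proof.
split=> [[[-> ->]//|[-> ->]]|[Es /eqP]]; first by rewrite addrC distrC.
rewrite eqr_norm2 => /orP[]/eqP Ed; [left|right]; split; lra.
Qed.

(** * The whitening data under the coupling *)

Section Coupling.
Variables (R : realType) (n d : nat) (X Xt : 'M[R]_(n, d)) (Dv : 'rV[R]_d).
Hypothesis rankX : \rank X = d.
Hypothesis knockoffX : is_knockoff X Xt Dv.

Let D := diag_mx Dv.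
Let Delta := (2%:R : R) *: invmx D.
Let omega (y : 'cV[R]_n) := invmx D *m ((X - Xt)^T *m y) - betahat X y.
Let bt y := betatilde X y (omega y).

Let D_gt0 j : 0 < Dv 0 j. Proof. by case: knockoffX. Qed.

Let D_unit : D \in unitmx.
Proof.
rewrite unitmxE det_diag unitfE; apply/prodf_neq0 => i _; exact: lt0r_neq0.
Qed.

Lemma invmx_knockoff_diag : invmx D = diag_mx (\row_j (Dv 0 j)^-1).
Proof.
rewrite -[RHS]mul1mx -(mulVmx D_unit) -mulmxA mulmx_diag.
rewrite [X in _ *m X](_ : _ = 1%:M) ?mulmx1//.
by apply/matrixP => i j; rewrite !mxE mulfV ?lt0r_neq0.
Qed.

Let btE y : betatilde X y (omega y) = invmx D *m ((X - Xt)^T *m y).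
Proof. by rewrite /betatilde addrC subrK. Qed.

Lemma coupled_betatildeE y j : bt y j 0 = ((X - Xt)^T *m y) j 0 / Dv 0 j.
Proof.
by rewrite /bt btE invmx_knockoff_diag mul_diag_mx !mxE mulrC.
Qed.

Lemma coupled_xiE y j :
  xi X y Delta (omega y) j 0 = ((X^T *m y) j 0 + (Xt^T *m y) j 0) / 2.
Proof.
rewrite /xi /Sigma invmxK /betahat /Sigma !mulmxA mulmxV ?gram_unitmx// mul1mx.
rewrite /Delta invmxZ; last by rewrite unitmxZ ?unitmx_inv// unitfE pnatr_eq0.
rewrite invmxK btE -scalemxAl mulmxA mulmxV// mul1mx.
rewrite [(X - Xt)^T]linearB /= mulmxBl !mxE; lra.
Qed.

Lemma sgr_betatilde y j : Num.sg (bt y j 0) = Num.sg (((X - Xt)^T *m y) j 0).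
Proof. by rewrite coupled_betatildeE sgrM sgrV (gtr0_sg (D_gt0 j)) mulr1. Qed.

Lemma coupled_data_unordered_pairs y y' :
  (forall j, same_unordered_pair ((X^T *m y) j 0) ((Xt^T *m y) j 0)
                                 ((X^T *m y') j 0) ((Xt^T *m y') j 0)) <->
  xi X y Delta (omega y) = xi X y' Delta (omega y') /\
  map_mx Num.norm (bt y) = map_mx Num.norm (bt y').
Proof.
have contrastE z j : ((X - Xt)^T *m z) j 0 = (X^T *m z) j 0 - (Xt^T *m z) j 0.
  by rewrite [(X - Xt)^T]linearB /= mulmxBl !mxE.
split=> [pairs|[Exi Ebt] j].
  split; apply/colP => j; have /same_unordered_pair_sumdiff[Es Ed] := pairs j.
    by rewrite !coupled_xiE Es.
  by rewrite [LHS]mxE [RHS]mxE !coupled_betatildeE !contrastE !normrM Ed.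
apply/same_unordered_pair_sumdiff; split.
  have := congr1 (fun v : 'cV[R]_d => v j 0) Exi; rewrite !coupled_xiE => h; lra.
have := congr1 (fun v : 'cV[R]_d => v j 0) Ebt.
rewrite /= [LHS]mxE [RHS]mxE !coupled_betatildeE !contrastE !normrM; apply: mulIf.
by rewrite normr_eq0 invr_eq0 gt_eqF.
Qed.

End Coupling.

(** For (a): passing from [W] to [Wstar] cancels the sign of [u], leaving only [psi] and whether [u]
    vanishes. *)
Lemma sgr_mul_mismatch (R : realType) (u : R) (b : bool) :
  Num.sg u * (-1) ^+ (Num.sg u != sgnval R b) = if u == 0 then 0 else sgnval R b.
Proof.
have N11 : (-1 == 1 :> R) = false by apply/negbTE/eqP => h; lra.
case: (sgrP u) => [_|u0|u0]; rewrite ?mul0r//; case: b => /=;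
  by rewrite ?eqxx ?(eq_sym 1) ?N11 /= ?expr0 ?expr1 ?mulr1 ?mulrNN ?mul1r ?mulr1.
Qed.

(** For (b): with [psi] the sign of [Wstar], a match with the sign of [betatilde] happens exactly
    when [W] is positive. *)
Lemma sgr_eq_sgnval (R : realType) (u v : R) : u != 0 -> v != 0 ->
  (Num.sg u == sgnval R (0 < Num.sg u * v)) = (0 < v).
Proof.
have N11 : (-1 == 1 :> R) = false by apply/negbTE/eqP => h; lra.
case: (sgrP u) => // _ _ v0; rewrite ?mul1r ?mulN1r ?oppr_gt0.
  by rewrite /sgnval; case: ifP => _; rewrite ?eqxx // eq_sym N11.
by case: (ltrgtP v 0) v0 => //= _ _; rewrite ?eqxx ?N11.
Qed.

(** * Construction of the statistics in (a) and of the implementation in (b) *)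

Theorem theorem1 (R : realType) (n d : nat) (X Xt : 'M[R]_(n, d))
    (Dv : 'rV[R]_d) (alpha : R) :
  (2 * d <= n)%N -> \rank X = d -> is_knockoff X Xt Dv -> 0 < alpha < 1 ->
  let D := diag_mx Dv in
  let Delta := (2%:R : R) *: invmx D in
  let omega (y : 'cV[R]_n) := invmx D *m ((X - Xt)^T *m y) - betahat X y in
  (* (a) *)
  (forall I : implementation R d,
     exists W : Wstat R n d,
       unordered_pair_property X Xt W /\
       forall y : 'cV[R]_n,
         kplus_rej (W y) alpha = whitening_rej X Delta (omega y) I alpha y) /\
  (* (b) : y = X beta + eps, eps ~ N_n(0, sigma^2 I_n) *)
  (forall (d0 : measure_display) (Omega : measurableType d0)
          (P : probability Omega R) (beta : 'cV[R]_d) (sigma : R)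
          (eps : 'I_n -> Omega -> R),
     0 < sigma -> iid_gaussian_noise P sigma eps ->
     let y (w : Omega) : 'cV[R]_n := X *m beta + \col_i eps i w in
     forall W : Wstat R n d, unordered_pair_property X Xt W ->
       {ae P, forall w, (forall j, 0 < `|W (y w) j|) /\
                        (forall i j, i != j -> `|W (y w) i| != `|W (y w) j|)} ->
       exists I : implementation R d,
         {ae P, forall w,
            kplus_rej (W (y w)) alpha
            = whitening_rej X Delta (omega (y w)) I alpha (y w)}).
Proof.
move=> _ rankX kX _ D Delta omega.
pose bt y := betatilde X y (omega y).
pose nbt y := map_mx Num.norm (bt y).
pose x y := xi X y Delta (omega y).
have pairsE y y' := coupled_data_unordered_pairs _ _ _ _ _ _ rankX kX y y'.
have sgbt y j : Num.sg (bt y j 0) = Num.sg (((X - Xt)^T *m y) j 0).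
  exact: sgr_betatilde.
split=> [I|d0 Omega P beta sigma eps sigma0 noise y W pairW W_ae].
  pose s y := (I (x y) (nbt y)).1; pose psi y := (I (x y) (nbt y)).2.
  (* Positions are at most [d - 1], so [|W|] is at least 1; a vanishing [bt] counts as a mismatch
     and makes [W] negative. *)
  pose W y j : R :=
    (-1) ^+ (Num.sg (bt y j 0) != sgnval R (psi y j)) * (d - (s y)^-1%g j)%:R.
  have rank_gt0 y j : 0 < (d - (s y)^-1%g j)%:R :> R by rewrite ltr0n subn_gt0.
  have normW y j : `|W y j| = (d - (s y)^-1%g j)%:R.
    by rewrite /W normrM normr_sign mul1r gtr0_norm.
  exists W; split=> [y y' /pairsE[xE nE] j|y].
    (* The vanishing of [bt] is visible in [|bt|]. *)
    have bt0 : (Num.sg (bt y j 0) == 0) = (Num.sg (bt y' j 0) == 0).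
      have := congr1 (fun v : 'cV[R]_d => v j 0) nE.
      by rewrite /= [LHS]mxE [RHS]mxE !sgr_eq0 -!(normr_eq0 (_ j 0)) => ->.
    rewrite /Wstar -!sgbt /W !mulrA !sgr_mul_mismatch.
    rewrite -(sgr_eq0 (bt y j 0)) bt0 sgr_eq0.
    have -> : psi y = psi y' by rewrite /psi /x /nbt xE nE.
    by have -> : s y = s y' by rewrite /s /x /nbt xE nE.
  apply: matched_rejections => [j|i j ij|j].
  - by rewrite normW.
  - by rewrite !normW !permK ltr_nat ltn_sub2l.
  - rewrite /W; case: eqP => _ /=; rewrite ?mul1r ?rank_gt0//.
    by rewrite expr1 mulN1r oppr_gt0 lt_gtF.
(* [ws] evaluates [Wstar] at an arbitrary response with data [(z, b)], or at 0 if there is none; the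
   unordered pair property makes the choice immaterial. *)
pose ws z b := Wstar X Xt W (xget 0 [set y | x y = z /\ nbt y = b]).
pose I : implementation R d := fun z b =>
  (xget 1%g [set s : {perm 'I_d} | forall i j : 'I_d, (i <= j)%N ->
               `|ws z b (s j)| <= `|ws z b (s i)|], fun j => 0 < ws z b j).
exists I.
have contrast_neq0 : {ae P, forall w j, ((X - Xt)^T *m y w) j 0 != 0}.
  apply: filter_forall => j.
  have [k ak] := knockoff_contrast_neq0 _ _ _ _ _ _ j kX.
  (* The coordinate vanishes iff its noise part equals minus its mean. *)
  have := gaussian_linear_form_atomless _ _ sigma0 _ _ _ _ _ noise
    (fun i => (X - Xt) i j) (- ((X - Xt)^T *m (X *m beta)) j 0) k ak.
  apply: filterS => w; apply: contra_neq => /eqP.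
  rewrite /y mulmxDr mxE addrC addr_eq0 => /eqP <-.
  by rewrite [RHS]mxE; apply: eq_bigr => i _; rewrite !mxE.
apply: filterS2 contrast_neq0 W_ae => w z0 [W0 Wdist].
have wsE j : ws (x (y w)) (nbt (y w)) j = Wstar X Xt W (y w) j.
  have [] := xgetPex 0 (ex_intro [set v | x v = x (y w) /\ nbt v = nbt (y w)]
    (y w) (conj erefl erefl)).
  by move=> xE nE; apply: pairW; apply/pairsE.
have nws j : `|ws (x (y w)) (nbt (y w)) j| = `|W (y w) j|.
  by rewrite wsE /Wstar normrM normr_sg z0 mul1r.
apply: matched_rejections => //.
(* Sorting gives a weak order; distinctness of the [|W j|] makes it strict. *)
- move=> i j ij; rewrite lt_neqAle Wdist /=; last first.
    by apply/eqP => /perm_inj E; rewrite E ltnn in ij.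
  rewrite -!nws.
  exact: (xgetPex 1%g (sorting_perm _ _ (fun j => `|ws (x (y w)) (nbt (y w)) j|))) (ltnW ij).
- move=> j; rewrite -/(bt _) sgbt /= wsE /Wstar.
  by rewrite sgr_eq_sgnval // -normr_gt0.
Qed.
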